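(* The generalized entropy map $X\mapsto h_{\rm top}(X)$ on $\Sigma_{\rm invariant}$ is computable at a nonempty shift space $X_0\in\Sigma_{\rm invariant}$ if and only if $X_0$ has zero topological entropy. Moreover, there is one Turing machine that uniformly computes the topological entropy at all shift spaces with zero entropy.
   Context: $\Sigma=\mathcal{A}^{\mathbb{Z}}$ is the full two-sided shift over a finite alphabet $\mathcal{A}=\{0,\dots,d-1\}$ with the product topology and left shift $f$. $\Sigma_{\rm invariant}$ is the set of (nonempty) shift spaces, i.e., closed shift-invariant subsets of $\Sigma$; $h_{\rm top}(X)=\lim_n\frac1n\log|\mathcal{L}(X,n)|$, where $\mathcal{L}(X,n)$ is the set of words of length $n$ occurring in points of $X$. An oracle for $X\in\Sigma_{\rm invariant}$ is a function which on input $n$ returns the finite list of all words of length $2n+1$ occurring in points of $X$ (equivalently, it lists the language of $X$ in order of nondecreasing length). A function $g:\Sigma_{\rm invariant}\to\mathbb{R}$ is computable at $X_0$ if there is an oracle Turing machine such that, given any oracle for $X_0$ and any $n\in\mathbb{N}$, it outputs a rational $q$ with $|q-g(X_0)|<2^{-n}$, and moreover $|q-g(X)|<2^{-n}$ for every $X\in\Sigma_{\rm invariant}$ having an oracle that agrees with the given one up to the largest precision queried in that computation. ''One Turing machine that uniformly computes at all shift spaces with zero entropy'' means that a single such machine witnesses computability at every $X_0$ with $h_{\rm top}(X_0)=0$. *)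

(* Defs.v *)
From HB Require Import structures.
From mathcomp Require Import all_boot all_order all_algebra.
From mathcomp Require Import all_classical all_reals all_analysis.

Set Implicit Arguments.
Unset Strict Implicit.
Unset Printing Implicit Defensive.

Import Order.TTheory GRing.Theory Num.Theory.
Import numFieldNormedType.Exports.

Local Open Scope classical_set_scope.
Local Open Scope ring_scope.

Definition full_shift (d : nat) : Type :=
  prod_topology (fun _ : int => discrete_topology 'I_d).

HB.instance Definition _ (d : nat) := Choice.on (full_shift d).
HB.instance Definition _ (d : nat) := Nbhs.on (full_shift d).
HB.instance Definition _ (d : nat) := Topological.on (full_shift d).

Definition left_shift (d : nat) (x : full_shift d) : full_shift d :=
  fun i => x (i + 1).

Record shift_space (d : nat) := ShiftSpace {
  points :> set (full_shift d);
  points_nonempty : points !=set0;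
  points_closed : closed points;
  points_invariant : @left_shift d @` points = points }.

Definition window (d : nat) (x : full_shift d) (i : int) (n : nat) :
    n.-tuple 'I_d :=
  [tuple x (i + j%:Z) | j < n].

Definition language (d : nat) (X : shift_space d) (n : nat) :
    {set n.-tuple 'I_d} :=
  [set w | `[< exists2 x, points X x & exists i, window x i n = w >]]%SET.

Definition htop (R : realType) (d : nat) (X : shift_space d) : R :=
  limn (fun n : nat => n%:R^-1 * ln (#|language X n|%:R : R)).

Definition oracle (d : nat) := forall n : nat, seq (n.*2.+1.-tuple 'I_d).

(** Each word of length [2n+1] is listed once; the order is free. *)
Definition is_oracle (d : nat) (phi : oracle d) (X : shift_space d) : Prop :=
  forall n, uniq (phi n) /\ phi n =i language X n.*2.+1.

(** Tape symbols: [One] is the tally mark of unary numerals, [Comma] separates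
    the components of a list, and the machine may use further symbols of its
    own, taken from a finite set [E]. *)
Inductive symbol (d : nat) (E : Type) : Type :=
  Blank | One | Comma | Minus | Letter of 'I_d | Aux of E.
Arguments Blank {d E}.
Arguments One {d E}.
Arguments Comma {d E}.
Arguments Minus {d E}.
Arguments Letter {d E}.
Arguments Aux {d E}.

Section SymbolFinType.
Variables (d : nat) (E : finType).

Definition symbol_code (s : symbol d E) : 'I_4 + ('I_d + E) :=
  match s with
  | Blank => inl (inord 0)
  | One => inl (inord 1)
  | Comma => inl (inord 2)
  | Minus => inl (inord 3)
  | Letter a => inr (inl a)
  | Aux e => inr (inr e)
  end.

Definition symbol_decode (c : 'I_4 + ('I_d + E)) : symbol d E :=
  match c with
  | inl k => nth Blank [:: Blank; One; Comma; Minus] k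
  | inr (inl a) => Letter a
  | inr (inr e) => Aux e
  end.

Lemma symbol_codeK : cancel symbol_code symbol_decode.
Proof. by case=> //=; rewrite inordK. Qed.

HB.instance Definition _ := Finite.copy (symbol d E) (can_type symbol_codeK).

End SymbolFinType.

(** A two-way infinite tape, blank outside a finite part: [lft] lists the cells
    left of the head, nearest first; [rgt] lists the scanned cell and the cells
    to its right. *)
Record tape (d : nat) (E : Type) := Tape {
  lft : seq (symbol d E);
  rgt : seq (symbol d E) }.

Inductive direction := MoveLeft | Stay | MoveRight.

Section Tapes.
Variables (d : nat) (E : finType).
Implicit Types (t : tape d E) (a : symbol d E) (w : seq (symbol d E)).

Definition scan t : symbol d E := head Blank (rgt t).

Definition write t a : tape d E := Tape (lft t) (a :: behead (rgt t)).

Definition move t (m : direction) : tape d E :=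
  match m with
  | MoveLeft => Tape (behead (lft t)) (head Blank (lft t) :: rgt t)
  | Stay => t
  | MoveRight => Tape (scan t :: lft t) (behead (rgt t))
  end.

Definition load w : tape d E := Tape [::] w.

(** The nonblank symbols of the tape, read from left to right. *)
Definition contents t : seq (symbol d E) :=
  [seq a <- catrev (lft t) (rgt t) | a != Blank].

Definition unary (n : nat) : seq (symbol d E) := nseq n One.

Definition list_code (n : nat) (ws : seq (n.-tuple 'I_d)) :
    seq (symbol d E) :=
  flatten [seq rcons [seq Letter x | x <- val u] Comma | u <- ws].

(** [w] denotes the rational [q], given by a sign and a fraction that need not
    be in lowest terms. *)
Definition denotes w (q : rat) : Prop :=
  exists (s : bool) (a b : nat),
    w = nseq s Minus ++ unary a ++ Comma :: unary b.+1 /\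
    q = (-1) ^+ s * (a%:Q / b.+1%:Q).

End Tapes.

(** A deterministic oracle Turing machine with finitely many tapes, three of
    which (not necessarily distinct) carry the input, the output and the
    exchanges with the oracle.  All
    the data of the transition table is finite, since [transition] has a finite
    domain. *)
Record machine (d : nat) := Machine {
  state : finType;
  aux : finType;
  tape_index : finType;
  input_tape : tape_index;
  output_tape : tape_index;
  oracle_tape : tape_index;
  start_state : state;
  halt_state : state;
  query_state : state;
  answer_state : state;
  transition : state -> {ffun tape_index -> symbol d aux} ->
    state * {ffun tape_index -> symbol d aux * direction} }.

Section Runs.
Variables (d : nat) (M : machine d) (phi : oracle d).

(** [queries] records the arguments on which the oracle has been called; the
    transition function has no access to it. *)
Record config := Config {
  current : state M;
  tapes : tape_index M -> tape d (aux M);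
  queries : seq nat }.

(** The query is the number of tally marks on the oracle tape, whose contents
    are then replaced by the answer. *)
Definition step (c : config) : config :=
  if current c == halt_state M then c
  else if current c == query_state M then
    let k := count_mem One (contents (tapes c (oracle_tape M))) in
    Config (answer_state M)
      (fun i => if i == oracle_tape M then load (list_code (aux M) (phi k))
                else tapes c i)
      (k :: queries c)
  else
    let: (q, act) := transition (current c) [ffun i => scan (tapes c i)] in
    Config q (fun i => move (write (tapes c i) (act i).1) (act i).2)
      (queries c).

Definition initial (n : nat) : config :=
  Config (start_state M)
    (fun i => load (if i == input_tape M then unary d (aux M) n else [::])) [::].

Definition run (n t : nat) : config := iter t step (initial n).

Definition outputs (n : nat) (q : rat) (ks : seq nat) : Prop :=
  exists t, [/\ current (run n t) = halt_state M,
    denotes (contents (tapes (run n t) (output_tape M))) q &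
    queries (run n t) = ks].

End Runs.

(** [q] must also be valid for every [X] with an oracle [psi] indistinguishable
    from [phi] in this run: [psi] and [phi] agree up to the largest precision
    in [ks] (no condition on [psi] if [ks] is empty). *)
Definition computes_at (R : realType) (d : nat) (M : machine d)
    (g : shift_space d -> R) (X0 : shift_space d) : Prop :=
  forall (phi : oracle d), is_oracle phi X0 -> forall n : nat,
  exists (q : rat) (ks : seq nat),
    [/\ outputs M phi n q ks,
        `|ratr q - g X0| < 2 ^- n &
        forall (X : shift_space d) (psi : oracle d), is_oracle psi X ->
          (forall j k, (j <= k)%N -> k \in ks -> psi j = phi j) ->
          `|ratr q - g X| < 2 ^- n].

Definition computable_at (R : realType) (d : nat) (g : shift_space d -> R)
    (X0 : shift_space d) : Prop :=
  exists M : machine d, computes_at M g X0.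

(* Main.v *)
(** Subadditivity of [ln #|L(X, N)|] (Fekete) gives [htop X <= ln #|L(X, N)| / N]
    for every [N > 0], with convergence to [htop X].  Hence, if
    [#|L(X, N)| <= 2 ^ m] for [N = 2 m 2 ^ n + 1], then [0 <= htop X < 2 ^ - n], a
    fact visible in a single oracle answer, and if [htop X = 0] then this happens
    for some [m].  So a machine which searches for such an [m] and then outputs
    [0] is correct at all shift spaces of zero entropy.  Conversely, any finite
    part of an oracle for [X] is shared by a shift space of zero entropy, so the
    computed approximations of [htop X] also approximate [0]. *)

From HB Require Import structures.
Require Import Defs.
From mathcomp Require Import all_boot all_order all_algebra.
From mathcomp Require Import all_classical all_reals all_analysis.
From mathcomp Require Import zify lra.

Set Implicit Arguments.
Unset Strict Implicit.
Unset Printing Implicit Defensive.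

Import Order.TTheory GRing.Theory Num.Theory.
Import numFieldNormedType.Exports.

Local Open Scope classical_set_scope.
Local Open Scope ring_scope.

(** * Fekete's lemma for nonnegative subadditive sequences *)

(** The limit is the infimum of the quotients: divide [n] by an [N] whose quotient nearly attains
    it; the remainder contributes a bounded amount, negligible after division by [n]. *)
Lemma fekete (R : realType) (u : nat -> R) :
    (forall n, 0 <= u n) -> (forall m n, u (m + n)%N <= u m + u n) ->
  exists l : R, [/\ n%:R^-1 * u n @[n --> \oo] --> l &
    forall n, (0 < n)%N -> l <= n%:R^-1 * u n].
Proof.
move=> u_ge0 u_sub.
pose E := [set n%:R^-1 * u n | n in [set n | (0 < n)%N]].
have hasE : has_inf E.
  split; first by exists (1%:R^-1 * u 1); exists 1%N.
  by exists 0 => _ [n _ <-]; rewrite mulr_ge0.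
have le_inf n : (0 < n)%N -> inf E <= n%:R^-1 * u n.
  by move=> n0; apply: ge_inf; [exact: hasE.2|exists n].
exists (inf E); split=> //.
(* Subadditivity does not force [u 0] to vanish, so the empty sum costs an extra [u 0]. *)
have u_mul N q r : u (q * N + r)%N <= q%:R * u N + r%:R * u 1 + u 0.
  elim: q => [|q IH].
    rewrite mul0n add0n mul0r add0r; elim: r => [|r IH]; first by rewrite mul0r add0r.
    by have := u_sub r 1%N; rewrite addn1 -natr1 mulrDl mul1r; lra.
  by rewrite mulSn -addnA -natr1 mulrDl mul1r; have := u_sub N (q * N + r)%N; lra.
apply/cvgrPdist_le => e e0.
have e20 : 0 < e / 2 by rewrite divr_gt0.
have [_ [N /= N0 <-] ltN] := inf_adherent e20 hasE.
have [K K_lt] : exists K : nat, (N%:R * u 1 + u 0) / (e / 2) < K%:R.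
  by eexists; apply: archi_boundP; rewrite divr_ge0 ?addr_ge0 ?mulr_ge0 // ltW.
exists (maxn K 1) => // n /=; rewrite geq_max => /andP[Kn n0].
have n0R : 0 < n%:R :> R by rewrite ltr0n.
have N0R : 0 < N%:R :> R by rewrite ltr0n.
rewrite distrC ger0_norm ?subr_ge0 ?le_inf // lerBlDl.
have u_n : u n <= (n %/ N)%:R * u N + (N%:R * u 1 + u 0).
  rewrite {1}(divn_eq n N); apply: le_trans (u_mul _ _ _) _.
  rewrite -addrA lerD2l lerD2r ler_wpM2r // ler_nat ltnW //.
  by rewrite ltn_mod N0.
have qN : (n %/ N)%:R * N%:R <= n%:R :> R by rewrite -natrM ler_nat leq_divM.
have tail : N%:R * u 1 + u 0 <= n%:R * (e / 2).
  rewrite -ler_pdivrMr //; apply/ltW/(lt_le_trans K_lt).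
  by rewrite ler_nat.
have uN : u N <= N%:R * (inf E + e / 2) by rewrite -ler_pdivrMl // ltW.
have inf_ge0 : 0 <= inf E.
  by apply: lb_le_inf; [exact: hasE.1|move=> _ [m _ <-]; rewrite mulr_ge0].
have lin : (n %/ N)%:R * u N <= n%:R * (inf E + e / 2).
  apply: le_trans (ler_wpM2l _ uN) _ => //.
  by rewrite mulrA ler_wpM2r // addr_ge0 // ltW.
rewrite ler_pdivrMl //; apply: le_trans u_n _.
by rewrite (splitr e) [X in _ <= _ * X]addrA [leRHS]mulrDr lerD.
Qed.

(** * Word counts, and entropy as the infimum of their growth rates *)

Section Languages.
Variables (R : realType) (d : nat).
Implicit Types (X : shift_space d) (x y : full_shift d).

Lemma tnth_window x i n j : tnth (window x i n) j = x (i + j%:Z).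
Proof. by rewrite tnth_mktuple. Qed.

Lemma eq_window x y i i' n :
  window x i n = window y i' n <->
  forall j, (j < n)%N -> x (i + j%:Z) = y (i' + j%:Z).
Proof.
split=> [xy j ltjn|xy].
  by have := congr1 (fun w => tnth w (Ordinal ltjn)) xy; rewrite !tnth_window.
by apply: eq_from_tnth => j; rewrite !tnth_window xy // ltn_ord.
Qed.

Lemma languageP X n w :
  reflect (exists2 x, points X x & exists i, window x i n = w)
    (w \in language X n).
Proof. by rewrite inE; apply: asboolP. Qed.

Lemma mem_window X x i n : points X x -> window x i n \in language X n.
Proof. by move=> Xx; apply/languageP; exists x => //; exists i. Qed.

Lemma language_gt0 X n : (0 < #|language X n|)%N.
Proof.
by have [x Xx] := points_nonempty X; apply/card_gt0P; exists (window x 0 n);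
  exact: mem_window.
Qed.

(** Cutting a word after [m] letters is injective, and both pieces are again words of [X]. *)
Lemma language_submul X m n :
  (#|language X (m + n)| <= #|language X m| * #|language X n|)%N.
Proof.
rewrite -cardsX.
pose cut (w : (m + n).-tuple 'I_d) :=
  ([tuple tnth w (lshift n j) | j < m], [tuple tnth w (rshift m j) | j < n]).
have cut_inj : injective cut.
  move=> v w vw; apply: eq_from_tnth => k; rewrite -(fintype.splitK k).
  case: (fintype.split k) => j /=.
    by have := congr1 (fun p => tnth p.1 j) vw; rewrite !tnth_mktuple.
  by have := congr1 (fun p => tnth p.2 j) vw; rewrite !tnth_mktuple.
rewrite -(card_imset _ cut_inj); apply/subset_leq_card/fintype.subsetP => _ /imsetP[w + ->].
case/languageP=> x Xx [i <-]; rewrite inE /=; apply/andP; split; apply/languageP;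
  exists x => //.
  by exists i; apply: eq_from_tnth => j; rewrite tnth_mktuple !tnth_window.
exists (i + m%:Z); apply: eq_from_tnth => j; rewrite tnth_mktuple !tnth_window /=.
by rewrite PoszD addrA.
Qed.

(** [limn] is informative only for convergent sequences; Fekete's lemma supplies the convergence.
    The bound at every single length is what one oracle answer can certify. *)
Lemma htop_cvg X :
  [/\ n%:R^-1 * ln (#|language X n|%:R : R) @[n --> \oo] --> htop R X,
      0 <= htop R X &
      forall n, (0 < n)%N -> htop R X <= n%:R^-1 * ln (#|language X n|%:R : R)].
Proof.
have c_gt0 n : (0 : R) < #|language X n|%:R by rewrite ltr0n language_gt0.
have c_ge0 n : 0 <= ln (#|language X n|%:R : R).
  by rewrite ln_ge0 // ler1n language_gt0.
have c_sub m n : ln (#|language X (m + n)|%:R : R) <=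
    ln (#|language X m|%:R : R) + ln (#|language X n|%:R : R).
  by rewrite -lnM ?posrE // ler_ln ?posrE ?mulr_gt0 // -natrM ler_nat language_submul.
have [l [cvg_l l_le]] := fekete c_ge0 c_sub.
have -> : htop R X = l by apply/cvg_lim => //; exact: Rhausdorff.
split=> //; rewrite -(cvg_lim (@Rhausdorff R) cvg_l).
apply: limr_ge; first by apply/cvg_ex; exists l.
by near=> n; rewrite mulr_ge0.
Unshelve. all: by end_near. Qed.

Lemma htop_eq0 X C :
  (forall n, #|language X n| <= C * n.+2)%N -> htop R X = 0.
Proof.
(* If [h > 0], then [(h n / 2)^2 <= exp (h n) <= C (n + 2)] for all [n > 0]. *)
move=> leC; have [_ h_ge0 h_le] := htop_cvg X; apply/eqP.
rewrite eq_le h_ge0 andbT leNgt; apply/negP => h_gt0; set h := htop R X in h_gt0 h_le.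
have sq n : (0 < n)%N -> (h / 2 * n%:R) ^+ 2 <= C%:R * n.+2%:R.
  move=> n0; have cn0 : (0 : R) < #|language X n|%:R by rewrite ltr0n language_gt0.
  have h_ln : h * n%:R <= ln (#|language X n|%:R : R).
    by rewrite mulrC -ler_pdivlMl ?ltr0n // h_le.
  apply: (@le_trans _ _ (#|language X n|%:R)); last by rewrite -natrM ler_nat.
  apply: (@le_trans _ _ (expR (h * n%:R))); last by rewrite -[leRHS]lnK ?posrE // ler_expR.
  have hn_ge0 : 0 <= h / 2 * n%:R by rewrite mulr_ge0 // divr_ge0 // ltW.
  have -> : h * n%:R = h / 2 * n%:R + h / 2 * n%:R by rewrite -mulrDl -splitr.
  rewrite expRD -expr2 ler_sqr ?nnegrE ?expR_ge0 //.
  by have := expR_ge1Dx (h / 2 * n%:R); lra.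
(* The factor 12 is 4 times 3: the left side of [sq] is [m (m h^2) / 4], hence exceeds [3 C m],
   which is at least [C (m + 2)] since [m >= 1]. *)
have [m gt_m] : exists m : nat, 12 * C%:R / h ^+ 2 < m%:R.
  by eexists; apply: archi_boundP; rewrite divr_ge0 ?mulr_ge0 ?sqr_ge0.
have m0 : (0 < m)%N.
  by rewrite -(ltr0n R); apply: le_lt_trans gt_m; rewrite divr_ge0 ?mulr_ge0 ?sqr_ge0.
have m1R : 1 <= m%:R :> R by rewrite ler1n.
have := sq _ m0; have -> : m.+2%:R = m%:R + 2 :> R by rewrite -addn2 natrD.
rewrite leNgt => /negP; apply.
move: gt_m; rewrite ltr_pdivrMr ?exprn_gt0 // => gt_m.
have C0 : 0 <= C%:R :> R by [].
have lt1 : m%:R * (12 * C%:R) < m%:R * (m%:R * h ^+ 2) :> R.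
  by rewrite ltr_pM2l // ltr0n.
have le1 : C%:R * 2 <= C%:R * (m%:R * 2) :> R by rewrite ler_wpM2l //; lra.
rewrite !expr2 in lt1 *; lra.
Qed.

End Languages.

(** * Shift spaces of zero entropy with prescribed words of a given length *)

Section PeriodicTails.
Variables (R : realType) (d : nat).
Implicit Types (X : shift_space d) (x y : full_shift d).

Lemma window_nbhs x i n : nbhs x [set y : full_shift d | window y i n = window x i n].
Proof.
have /filter_forall : forall j : 'I_n,
    \forall y \near x, (y : full_shift d) (i + j%:Z) = x (i + j%:Z).
  move=> j; have := @proj_continuous int (fun=> discrete_topology 'I_d) (i + j%:Z) x.
  move=> /(_ [set x (i + j%:Z)]); apply; apply: open_nbhs_nbhs; split=> //.
  exact: discrete_open.
apply: filterS => y xy; apply: eq_from_tnth => j.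
by rewrite !tnth_window.
Qed.

(** This is the orbit closure of [S], written so that closedness and invariance
    are immediate. *)
Definition hull_set (S : set (full_shift d)) : set (full_shift d) :=
  [set x | forall i n, exists2 y, S y & exists j, window y j n = window x i n].

Lemma hull_set_nonempty S : S !=set0 -> hull_set S !=set0.
Proof. by case=> y Sy; exists y => i n; exists y => //; exists i. Qed.

Lemma hull_set_closed S : closed (hull_set S).
Proof.
move=> x clx i n; have [y [Sy /= <-]] := clx _ (window_nbhs x i n).
exact: Sy.
Qed.

Lemma hull_set_invariant S : @left_shift d @` hull_set S = hull_set S.
Proof.
(* Membership in the hull constrains windows at all positions alike, so it survives translation; the
   offsets 1 and -1 give the two inclusions. *)
have shift (a b : int) x x' : (forall i, x' (i + a) = x (i + b)) ->
    hull_set S x -> hull_set S x'.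
  move=> xx' Sx i n; have [y Sy [j yx]] := Sx (i - a + b) n.
  exists y => //; exists j; rewrite yx; apply/eq_window => k _.
  have -> : i + k%:Z = i - a + k%:Z + a by lia.
  by rewrite xx'; congr (x _); lia.
apply/seteqP; split=> [_ [x Sx <-]|x Sx].
  by apply: (shift 0 1) Sx => i; rewrite addr0.
exists (fun i => x (i - 1)); first by apply: (shift 0 (-1)) Sx => i; rewrite addr0.
by apply/funext => i; rewrite /left_shift addrK.
Qed.

Definition hull S (S0 : S !=set0) : shift_space d :=
  ShiftSpace (hull_set_nonempty S0) (hull_set_closed (S := S)) (hull_set_invariant S).

(** Passing to the hull adds no words, so words can be counted on [S] itself, which need be neither
    closed nor invariant. *)
Lemma language_hullP S (S0 : S !=set0) n w :
  reflect (exists2 x, S x & exists i, window x i n = w) (w \in language (hull S0) n).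
Proof.
apply: (iffP (languageP _ _)) => [[x hx [i <-]]|[x Sx xw]]; first exact: hx.
by exists x => // i m; exists x => //; exists i.
Qed.

Lemma language_prefix X Y m n : (m <= n)%N ->
  language X n = language Y n -> language X m = language Y m.
Proof.
wlog suff sub : X Y / (m <= n)%N -> language X n = language Y n ->
    {subset language X m <= language Y m}.
  by move=> mn XY; apply/setP => w; apply/idP/idP; apply: sub.
move=> mn XY w /languageP[x Xx [i <-]].
have := mem_window i n Xx; rewrite XY => /languageP[y Yy [j /eq_window yx]].
apply/languageP; exists y => //; exists j; apply/eq_window => k km.
by apply: yx; apply: leq_trans mn.
Qed.

(** Fixing one successor and one predecessor of every word of length [n.+1], each
    word is continued to a point by iteration.  A word of length [m] of such a
    point which does not straddle the origin depends only on the state at one of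
    its ends, so there are linearly many words of length [m]. *)
Lemma exists_zero_entropy X n : exists Y : shift_space d,
  language Y n.+1 = language X n.+1 /\ htop R Y = 0.
Proof.
pose L := language X n.+1; pose word := n.+1.-tuple 'I_d.
(* Edges of the graph on words: [w] arises from [v] by dropping the first letter and appending
   one. *)
pose follows (v w : word) :=
  forall j : 'I_n, tnth w (widen_ord (leqnSn n) j) = tnth v (lift ord0 j).
have follows_window x i : follows (window x i n.+1) (window x (i + 1) n.+1).
  by move=> j; rewrite !tnth_window /= /bump /=; congr (x _); lia.
have /choice[s sP] : forall w, exists w', w \in L -> w' \in L /\ follows w w'.
  move=> w; case: (boolP (w \in L)) => [/languageP[x Xx [i <-]]|_]; last by exists w.
  by exists (window x (i + 1) n.+1) => _; split; [exact: mem_window|].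
have /choice[p pP] : forall w, exists w', w \in L -> w' \in L /\ follows w' w.
  move=> w; case: (boolP (w \in L)) => [/languageP[x Xx [i <-]]|_]; last by exists w.
  exists (window x (i - 1) n.+1) => _; split; first exact: mem_window.
  by have := follows_window x (i - 1); rewrite subrK.
have sL w k : w \in L -> iter k s w \in L.
  by move=> Lw; elim: k => //= k /sP[].
have pL w k : w \in L -> iter k p w \in L.
  by move=> Lw; elim: k => //= k /pP[].
(* The chosen two-sided path through [w] at time 0; [Negz k] is [-(k + 1)], hence [k.+1] predecessor
   steps. *)
pose u w (i : int) := match i with Posz k => iter k s w | Negz k => iter k.+1 p w end.
have uL w i : w \in L -> u w i \in L by case: i => k Lw; [exact: sL|exact: pL].
have uP w i : w \in L -> follows (u w i) (u w (i + 1)).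
  move=> Lw; case: i => k.
    by rewrite addrC; exact: (sP _ (sL w k Lw)).2.
  case: k => [|k]; last first.
    have -> : Negz k.+1 + 1 = Negz k by lia.
    exact: (pP _ (pL w k.+1 Lw)).2.
  have -> : Negz 0 + 1 = 0 by [].
  exact: (pP _ Lw).2.
(* The point spelled by the first letters along the path; by [uP], the word at time [i] is then its
   window at [i]. *)
pose y w : full_shift d := fun i => tnth (u w i) ord0.
have yE w i j (ltj : (j < n.+1)%N) : w \in L -> y w (i + j%:Z) = tnth (u w i) (Ordinal ltj).
  move=> Lw; elim: j i ltj => [|j IH] i ltj.
    by rewrite addr0 /y; congr tnth; exact: val_inj.
  have -> : i + j.+1%:Z = i + 1 + j%:Z by lia.
  have ltj' : (j < n)%N by [].
  rewrite (IH _ (ltnW ltj)); have := uP w i Lw (Ordinal ltj').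
  by congr (_ = _); congr tnth; exact: val_inj.
have window_y w i : w \in L -> window (y w) i n.+1 = u w i.
  by move=> Lw; apply: eq_from_tnth => -[j ltj]; rewrite tnth_window yE.
pose S := [set y w | w in [set` L]].
have S0 : S !=set0.
  by have /card_gt0P[w Lw] := language_gt0 X n.+1; exists (y w), w.
exists (hull S0); split.
  apply/setP => w; apply/language_hullP/idP => [[_ [v Lv <-] [i <-]]|Lw].
    by rewrite window_y //; exact: uL.
  by exists (y w); [exists w|exists 0; rewrite window_y].
apply: (@htop_eq0 _ _ _ #|L|) => m.
(* [f] covers windows starting at a nonnegative position, from their initial state; [g] covers
   windows far to the left, from the state just after their end; [c] lists the at most [m] remaining
   starting positions for each word. The total is [#|L| * m.+2]. *)
pose f v : m.-tuple 'I_d := [tuple tnth (iter j s v) ord0 | j < m].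
pose g v : m.-tuple 'I_d := [tuple tnth (iter (m - j) p v) ord0 | j < m].
pose c (wa : word * 'I_m) := window (y wa.1) (Negz wa.2) m.
apply: (@leq_trans #|f @: L :|: g @: L :|: c @: finset.setX L [set: 'I_m]%SET|).
  apply/subset_leq_card/fintype.subsetP => _ /language_hullP[_ [w Lw <-] [i <-]].
  rewrite 2!finset.in_setU; case: i => [k|a].
    apply/orP; left; apply/orP; left; apply/imsetP; exists (iter k s w); first exact: sL.
    apply: eq_from_tnth => j; rewrite tnth_window tnth_mktuple -iterD /y -PoszD /=.
    by rewrite addnC.
  have [am|ma] := ltnP a m.
    by apply/orP; right; apply/imsetP; exists (w, Ordinal am);
      rewrite // finset.in_setX Lw finset.in_setT.
  apply/orP; left; apply/orP; right; apply/imsetP; exists (iter (a - m).+1 p w).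
    exact: pL.
  apply: eq_from_tnth => j; rewrite tnth_window tnth_mktuple -iterD /y.
  have jm := ltn_ord j; have -> : Negz a + j%:Z = Negz (a - j) by lia.
  by have -> : (m - j + (a - m).+1)%N = (a - j).+1 by lia.
apply: leq_trans (leq_card_setU _ _) _; rewrite 2!mulnS addnA.
apply: leq_add; last by apply: leq_trans (leq_imset_card _ _) _; rewrite cardsX cardsT card_ord.
apply: leq_trans (leq_card_setU _ _) _.
by apply: leq_add; exact: leq_imset_card.
Qed.

End PeriodicTails.

(** * Computability forces zero entropy *)

Section NotComputable.
Variables (R : realType) (d : nat).

Lemma computable_htop_eq0 (X0 : shift_space d) :
  computable_at (@htop R d) X0 -> htop R X0 = 0.
Proof.
(* Agreement of oracles is equality of lists, order included; [enum] makes equal languages give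
   equal lists. *)
move=> [M MP]; pose phi : oracle d := fun n => enum (language X0 n.*2.+1).
have phiP : is_oracle phi X0.
  by move=> n; split; [exact: enum_uniq|move=> w; rewrite mem_enum].
apply/eqP; rewrite -normr_le0; apply/ler_addgt0Pl => e e0; rewrite addr0.
have [n n_gt] : exists n : nat, 2 / e < n%:R.
  by eexists; apply: archi_boundP; rewrite divr_ge0 // ltW.
have [q [ks [_ q_h q_all]]] := MP phi phiP n.
(* The largest precision queried, 0 if there is none; the longest words seen then have length
   [K.*2.+1]. *)
pose K := (\max_(k <- ks) k)%N.
have [Y [YX hY]] := exists_zero_entropy R X0 K.*2.
have sameK j : (j <= K)%N -> language Y j.*2.+1 = language X0 j.*2.+1.
  by move=> jK; apply: language_prefix YX; rewrite ltnS leq_double.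
pose psi : oracle d := fun j => enum (language Y j.*2.+1).
have psiP : is_oracle psi Y.
  by move=> j; split; [exact: enum_uniq|move=> w; rewrite mem_enum].
have q_0 : `|ratr q - 0| < 2 ^- n :> R.
  rewrite -hY; apply: q_all psiP _ => j k jk kks; rewrite /psi /phi sameK //.
  by apply: leq_trans jk _; exact: leq_bigmax_seq.
have n_exp : e^-1 * 2 < 2 ^+ n.
  apply: lt_trans (_ : n%:R < _); first by rewrite mulrC.
  by rewrite -natrX ltr_nat ltn_expl.
have e_n : 2 ^- n * 2 <= e.
  by rewrite mulrC ler_pdivrMr ?exprn_gt0 // -ler_pdivrMl // ltW.
rewrite subr0 in q_0.
have -> : htop R X0 = ratr q - (ratr q - htop R X0) by lra.
apply: le_trans (ler_normB _ _) _; lra.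
Qed.

End NotComputable.

(** * The searching machine and the encoding of its counters on tapes *)

Inductive tape_name := Input | Output | Oracle | Power | Precision | Words | Spare | Spare'.

Definition tape_code (i : tape_name) : 'I_8 :=
  match i with
  | Input => @Ordinal 8 0 isT | Output => @Ordinal 8 1 isT
  | Oracle => @Ordinal 8 2 isT | Power => @Ordinal 8 3 isT
  | Precision => @Ordinal 8 4 isT | Words => @Ordinal 8 5 isT
  | Spare => @Ordinal 8 6 isT | Spare' => @Ordinal 8 7 isT
  end.

Definition tape_decode (k : 'I_8) : tape_name :=
  nth Input [:: Input; Output; Oracle; Power; Precision; Words; Spare; Spare'] k.

Lemma tape_codeK : cancel tape_code tape_decode. Proof. by case. Qed.

HB.instance Definition _ := Finite.copy tape_name (can_type tape_codeK).

Inductive phase :=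
  | Start | Double1 | Double2 | Double3 | Double4 | Ask | Read | Compare | Skip
  | Grow1 | Grow2 | Next1 | Next2 | Next3 | Next4 | Stop.

Definition phase_code (q : phase) : 'I_16 :=
  match q with
  | Start => @Ordinal 16 0 isT | Double1 => @Ordinal 16 1 isT
  | Double2 => @Ordinal 16 2 isT | Double3 => @Ordinal 16 3 isT
  | Double4 => @Ordinal 16 4 isT | Ask => @Ordinal 16 5 isT
  | Read => @Ordinal 16 6 isT | Compare => @Ordinal 16 7 isT
  | Skip => @Ordinal 16 8 isT | Grow1 => @Ordinal 16 9 isT
  | Grow2 => @Ordinal 16 10 isT | Next1 => @Ordinal 16 11 isT
  | Next2 => @Ordinal 16 12 isT | Next3 => @Ordinal 16 13 isT
  | Next4 => @Ordinal 16 14 isT | Stop => @Ordinal 16 15 isT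
  end.

Definition phase_decode (k : 'I_16) : phase :=
  nth Start [:: Start; Double1; Double2; Double3; Double4; Ask; Read; Compare;
    Skip; Grow1; Grow2; Next1; Next2; Next3; Next4; Stop] k.

Lemma phase_codeK : cancel phase_code phase_decode. Proof. by case. Qed.

HB.instance Definition _ := Finite.copy phase (can_type phase_codeK).

(** [Some (x, Y, z, p)]: if the counter [x] is zero then go to [z], else
    decrement [x], increment all counters in [Y] and go to [p].  The phase [Ask]
    is always entered with [Power = 2 ^ n], [Words = 2 ^ m] and
    [Precision = Oracle = m * 2 ^ n], for [m = 0, 1, 2, ...]; then [Read] and
    [Compare] halt if there are at most [2 ^ m] words in the answer, and otherwise
    leave [2 ^ m] on [Spare]. *)
Definition counter_instruction (q : phase) :
    option (tape_name * seq tape_name * phase * phase) :=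
  match q with
  | Double1 => Some (Input, [::], Ask, Double2)
  | Double2 => Some (Power, [:: Spare; Spare'], Double3, Double2)
  | Double3 => Some (Spare, [:: Power], Double4, Double3)
  | Double4 => Some (Spare', [:: Power], Double1, Double4)
  | Compare => Some (Words, [:: Spare], Skip, Read)
  | Grow1 => Some (Spare, [:: Words; Spare'], Grow2, Grow1)
  | Grow2 => Some (Spare', [:: Words], Next1, Grow2)
  | Next1 => Some (Precision, [:: Spare; Oracle], Next2, Next1)
  | Next2 => Some (Power, [:: Spare; Spare'; Oracle], Next3, Next2)
  | Next3 => Some (Spare, [:: Precision], Next4, Next3)
  | Next4 => Some (Spare', [:: Power], Ask, Next4)
  | _ => None
  end.

Section EntropyMachine.
Variable d : nat.
Notation sym := (symbol d void).
Notation actions := {ffun tape_name -> sym * direction}.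
Implicit Types (i x : tape_name) (Y : seq tape_name) (s : {ffun tape_name -> sym}).

(** The input is consumed mark by mark up to a blank, whereas a counter is zero when its head is
    back on the marker [Comma]. *)
Definition is_zero i (a : sym) : bool :=
  match i, a with Input, Blank => true | Input, _ => false | _, Comma => true | _, _ => false end.

Definition keep s : actions := [ffun i => (s i, Stay)].

Definition skip_oracle s : actions :=
  [ffun i => (s i, if i is Oracle then MoveRight else Stay)].

(** On counters only the head moves; on [Oracle] an increment must write a mark, because the query
    counts marks. *)
Definition count x Y s : actions :=
  [ffun i => if i == x then (s i, if i is Input then MoveRight else MoveLeft)
    else if i \in Y then (if i is Oracle then One else s i, MoveRight)
    else (s i, Stay)].

(** [Start] lays the markers; the right moves on [Power] and [Words] set both to 1. The comma on
    [Output], followed by the mark written on entering [Stop] from [Read], spells the fraction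
    0/1. *)
Definition entropy_transition (q : phase) s : phase * actions :=
  if counter_instruction q is Some (x, Y, z, p) then
    if is_zero x (s x) then (z, keep s) else (p, count x Y s)
  else match q with
  | Start => (Double1, [ffun i => match i with
      | Output | Power | Words => (Comma, MoveRight)
      | Precision | Spare | Spare' => (Comma, Stay)
      | Input | Oracle => (s i, Stay) end])
  | Read => match s Oracle with
      | Blank => (Stop, [ffun i => (if i is Output then One else s i, Stay)])
      | Comma => (Compare, skip_oracle s)
      | _ => (Read, skip_oracle s) end
  | Skip => if s Oracle is Blank then (Grow1, keep s) else (Skip, skip_oracle s)
  | _ => (Stop, keep s)
  end.

Definition entropy_machine : machine d :=
  Machine Input Output Oracle Start Stop Ask Read entropy_transition.

(** The value of a counter is the distance of the head from a cell holding [Comma]. *)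
Definition counter_tape (m r : nat) : tape d void :=
  if m is m'.+1 then Tape (rcons (nseq m' Blank) Comma) (nseq r Blank)
  else Tape [::] (Comma :: nseq r Blank).

(** The existential [r] absorbs trailing blanks, which change the list but not the tape it stands
    for. On [Oracle], [m] counts the marks left of the head and [w] is the unread part of the
    answer. *)
Definition represents (m : nat) (w : seq sym) i (t : tape d void) : Prop :=
  exists r, match i with
  | Input => rgt t = nseq m One ++ nseq r Blank
  | Output => t = Tape [:: Comma] (nseq m One ++ nseq r Blank)
  | Oracle => count_mem One (lft t) = m /\ rgt t = w ++ nseq r Blank
  | _ => t = counter_tape m r
  end.

Definition is_counter i := if i is (Input | Output | Oracle) then false else true.

Lemma write_scan l u r : exists r',
  write (Tape l (u ++ nseq r Blank)) (scan (Tape l (u ++ nseq r Blank))) =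
  Tape l (u ++ nseq r' Blank) :> tape d void.
Proof. by case: u => [|a u]; [case: r => [|r]; [exists 1%N|exists r.+1]|exists r]. Qed.

Lemma represents_keep m w i t :
  represents m w i t -> represents m w i (move (write t (scan t)) Stay).
Proof.
have counter_keep : (exists r, t = counter_tape m r) ->
    exists r, write t (scan t) = counter_tape m r.
  case=> r ->; case: m => [|m] /=.
    by have [r' ->] := write_scan [::] [:: Comma] r; exists r'.
  by have [r' ->] := write_scan (rcons (nseq m Blank) Comma) [::] r; exists r'.
case: i => //=; case=> r.
- by case: t counter_keep => l g _ /= ->; have [r' ->] := write_scan l (nseq m One) r; exists r'.
- by move=> ->; have [r' ->] := write_scan [:: Comma] (nseq m One) r; exists r'.
- by case: t counter_keep => l g _ /= [<- ->]; have [r' ->] := write_scan l w r; exists r'.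
Qed.

Lemma represents_incr m w i t : is_counter i ->
  represents m w i t -> represents m.+1 w i (move (write t (scan t)) MoveRight).
Proof.
have : (exists r, t = counter_tape m r) ->
    exists r, move (write t (scan t)) MoveRight = counter_tape m.+1 r.
  by case=> r ->; case: m => [|m]; [exists r|case: r => [|r]; [exists 0%N|exists r]].
by case: i.
Qed.

Lemma represents_decr m w i t : is_counter i ->
  represents m.+1 w i t -> represents m w i (move (write t (scan t)) MoveLeft).
Proof.
have : (exists r, t = counter_tape m.+1 r) ->
    exists r, move (write t (scan t)) MoveLeft = counter_tape m r.
  by case=> r ->; case: m => [|m]; case: r => [|r];
    [exists 1%N|exists r.+1|exists 2%N|exists r.+2].
by case: i.
Qed.

Lemma is_zero_scan m w i t : i != Output -> i != Oracle ->
  represents m w i t -> is_zero i (scan t) = (m == 0%N).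
Proof.
case: i => // _ _ [r]; try by move=> ->; case: m => //= m; case: r.
by case: t => l g /= ->; case: m => //; case: r.
Qed.

Lemma represents_input m w t :
  represents m.+1 w Input t -> represents m w Input (move (write t (scan t)) MoveRight).
Proof. by case: t => l g [r] /= ->; exists r. Qed.

Lemma represents_oracle_incr m t :
  represents m [::] Oracle t -> represents m.+1 [::] Oracle (move (write t One) MoveRight).
Proof. by case: t => l g [r] /= [<- ->]; exists r.-1; rewrite /= eqxx; case: r. Qed.

Lemma represents_oracle_skip m w a t : a != One ->
  represents m (a :: w) Oracle t -> represents m w Oracle (move (write t (scan t)) MoveRight).
Proof. by case: t => l g aN1 [r] /= [<- ->]; exists r; rewrite /= (negPf aN1). Qed.

(** The values left by an instruction that loops on its own phase until [x] is empty. *)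
Definition transfer x Y (v : tape_name -> nat) i :=
  if i == x then 0%N else if i \in Y then (v i + v x)%N else v i.

(** * Correctness of the machine, phase by phase *)

Section Simulation.
Variable phi : oracle d.
Notation cfg := (config entropy_machine).

Definition holds (q : phase) (v : tape_name -> nat) (w : seq sym) (ks : seq nat) (c : cfg) :=
  [/\ current c = q, queries c = ks & forall i, represents (v i) w i (tapes c i)].

(** Total correctness with the number of steps hidden, so that phases compose without counting. *)
Variant leads (I J : cfg -> Prop) : Prop :=
  Leads of forall c, I c -> exists t, J (iter t (step phi) c).

Lemma leads_refl I : leads I I.
Proof. by split=> c Ic; exists 0%N. Qed.

Lemma leads_trans I J K : leads I J -> leads J K -> leads I K.
Proof.
by move=> [IJ] [JK]; split=> c /IJ[t /JK[t' Kc]]; exists (t' + t)%N; rewrite iterD.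
Qed.

Lemma leads_step I J : (forall c, I c -> J (step phi c)) -> leads I J.
Proof. by move=> IJ; split=> c /IJ Jc; exists 1%N. Qed.

Lemma step_transition q v w ks c : q != Stop -> q != Ask -> holds q v w ks c ->
  step phi c = let: (p, act) := entropy_transition q [ffun i => scan (tapes c i)] in
    Config (M := entropy_machine) p
      (fun i => move (write (tapes c i) (act i).1) (act i).2) ks.
Proof.
move=> /negPf qS /negPf qA; case: c => q' tp ks' [/= -> -> _].
by rewrite /step /= qS qA.
Qed.

Lemma counter_instructionP q x Y z p : counter_instruction q = Some (x, Y, z, p) ->
  [/\ q != Stop, q != Ask, x = Input \/ is_counter x, x \notin Y &
    all (fun i => is_counter i || (i == Oracle)) Y].
Proof. by case: q => //= -[<- <- _ _]; split=> //; try (by left); right. Qed.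

(** Incrementing [Oracle] overwrites the scanned cell, hence the condition that no answer remains
    unread. *)
Lemma counter_step q x Y z p v w ks : counter_instruction q = Some (x, Y, z, p) ->
    (Oracle \in Y -> w = [::]) ->
  leads (holds q v w ks)
    (if v x == 0%N then holds z v w ks else
     holds p (fun i => if i == x then (v i).-1 else if i \in Y then (v i).+1 else v i) w ks).
Proof.
move=> qE OY; apply: leads_step => c cq.
have [qS qA xP xY /allP YP] := counter_instructionP qE.
rewrite (step_transition qS qA cq) /entropy_transition qE ffunE.
case: cq => _ _ cv; rewrite (is_zero_scan _ _ (cv x)); first last.
- by case: xP => [->|]; case: x {qE xY cv}.
- by case: xP => [->|]; case: x {qE xY cv}.
case: ifPn => [vx0|vx0]; split=> // i /=; rewrite !ffunE.
  exact: represents_keep.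
case: eqVneq => [->|ix] /=; last first.
  case: ifPn => [iY|_]; last exact: represents_keep.
  have := cv i; case/orP: (YP _ iY) => [iC|/eqP iO].
    by move=> /(represents_incr iC); case: i iC {ix iY}.
  by move: iY; rewrite iO => /OY ->; exact: represents_oracle_incr.
have := cv x; case: (v x) vx0 => // m _; case: xP => [->|xC]; first exact: represents_input.
by move=> /(represents_decr xC); case: x xC {qE xY}.
Qed.

Lemma counter_zero q x Y z p v w ks : counter_instruction q = Some (x, Y, z, p) ->
  (Oracle \in Y -> w = [::]) -> v x = 0%N -> leads (holds q v w ks) (holds z v w ks).
Proof. by move=> qE OY vx; have := counter_step v ks qE OY; rewrite vx. Qed.

Lemma counter_pos q x Y z p v v' w ks : counter_instruction q = Some (x, Y, z, p) ->
    (Oracle \in Y -> w = [::]) -> v x != 0%N ->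
    (fun i => if i == x then (v i).-1 else if i \in Y then (v i).+1 else v i) =1 v' ->
  leads (holds q v w ks) (holds p v' w ks).
Proof.
by move=> qE OY /negPf vx /funext <-; have := counter_step v ks qE OY; rewrite vx.
Qed.

Lemma leads_transfer q x Y z v v' ks : counter_instruction q = Some (x, Y, z, q) ->
  transfer x Y v =1 v' -> leads (holds q v [::] ks) (holds z v' [::] ks).
Proof.
move=> qE /funext <-; have [_ _ _ xY _] := counter_instructionP qE.
have [m] := ubnP (v x); elim: m v => // m IH v vm.
have [vx0|vx0] := eqVneq (v x) 0%N.
  have -> : transfer x Y v = v; last exact: counter_zero qE _ vx0.
  apply/funext => i; rewrite /transfer vx0 addn0 if_same.
  by case: eqP => // ->.
apply: leads_trans (counter_pos (w := [::]) ks qE _ vx0 (frefl _)) _ => //.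
(* One turn of the loop keeps [v i + v x] constant for [i] in [Y], so the final values are
   unchanged. *)
set v1 := fun i => _; have -> : transfer x Y v = transfer x Y v1.
  apply/funext => i; rewrite /transfer /v1 eqxx; case: eqP => // _.
  by case: ifP => // _; rewrite addSnnS prednK // lt0n.
by apply: IH; rewrite /v1 eqxx prednK // lt0n.
Qed.

Definition values n o e a k m b b' i : nat :=
  match i with
  | Input => n | Output => o | Oracle => e | Power => a
  | Precision => k | Words => m | Spare => b | Spare' => b'
  end.

(** Each input mark doubles [Power]: it is copied to both spare counters, and both are poured
    back. *)
Lemma leads_double n a ks :
  leads (holds Double1 (values n 0 0 a 0 1 0 0) [::] ks)
    (holds Ask (values 0 0 0 (a * 2 ^ n) 0 1 0 0) [::] ks).
Proof.
elim: n a => [|n IH] a; first by rewrite muln1; exact: (@counter_zero Double1).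
apply: (@leads_trans _ (holds Double2 (values n 0 0 a 0 1 0 0) [::] ks)).
  by apply: (@counter_pos Double1) => //; case.
apply: (@leads_trans _ (holds Double3 (values n 0 0 0 0 1 a a) [::] ks)).
  by apply: leads_transfer => //; case.
apply: (@leads_trans _ (holds Double4 (values n 0 0 a 0 1 0 a) [::] ks)).
  by apply: leads_transfer => //; case.
rewrite expnS mulnA muln2 -addnn; apply: leads_trans (IH _).
by apply: leads_transfer => //; case.
Qed.

(** Reading a counter empties it. [Spare'] therefore keeps the second copy needed to double [m], and
    later the copy from which [Power] is restored. *)
Lemma leads_grow a k m ks :
  leads (holds Grow1 (values 0 0 0 a k 0 m 0) [::] ks)
    (holds Ask (values 0 0 (k + a) a (k + a) (m + m) 0 0) [::] ks).
Proof.
apply: (@leads_trans _ (holds Grow2 (values 0 0 0 a k m 0 m) [::] ks)).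
  by apply: leads_transfer => //; case.
apply: (@leads_trans _ (holds Next1 (values 0 0 0 a k (m + m) 0 0) [::] ks)).
  by apply: leads_transfer => //; case.
apply: (@leads_trans _ (holds Next2 (values 0 0 k a 0 (m + m) k 0) [::] ks)).
  by apply: leads_transfer => //; case.
apply: (@leads_trans _ (holds Next3 (values 0 0 (k + a) 0 0 (m + m) (k + a) a) [::] ks)).
  by apply: leads_transfer => //; case.
apply: (@leads_trans _ (holds Next4 (values 0 0 (k + a) 0 (k + a) (m + m) 0 a) [::] ks)).
  by apply: leads_transfer => //; case.
by apply: leads_transfer => //; case.
Qed.

Lemma holds_skip_oracle q p v a w ks c : q != Stop -> q != Ask -> a != One ->
    holds q v (a :: w) ks c ->
    (forall s, s Oracle = a -> entropy_transition q s = (p, skip_oracle s)) ->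
  holds p v w ks (step phi c).
Proof.
move=> qS qA aN1 cq trans; rewrite (step_transition qS qA cq).
case: cq => _ _ cv; rewrite trans; last first.
  by rewrite ffunE; case: (cv Oracle) => r [_]; rewrite /scan => ->.
split=> // i /=; rewrite !ffunE.
have := cv i; case: i; try exact: represents_keep.
exact: represents_oracle_skip.
Qed.

Lemma leads_read_word v u w ks :
  leads (holds Read v (map Letter u ++ Comma :: w) ks) (holds Compare v w ks).
Proof.
elim: u => [|a u IH]; last apply: leads_trans IH; apply: leads_step => c cq;
  (apply: holds_skip_oracle cq _ => //; try by apply/eqP);
  by move=> s; rewrite /entropy_transition /= => ->.
Qed.

Lemma leads_skip v w ks : all (fun a => (a != One) && (a != Blank)) w ->
  leads (holds Skip v w ks) (holds Grow1 v [::] ks).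
Proof.
elim: w => [_|a w IH /= /andP[/andP[a1 aB] wP]].
  apply: leads_step => c cq; rewrite (step_transition _ _ cq) // /entropy_transition /=.
  case: cq => _ _ cv; rewrite ffunE.
  have [r [_ Or]] := cv Oracle; have -> : scan (tapes c Oracle) = Blank.
    by rewrite /scan Or; case: r {Or}.
  by split=> // i /=; rewrite !ffunE; exact: represents_keep.
apply: leads_trans (IH wP); apply: leads_step => c cq.
apply: holds_skip_oracle cq _ => // s; rewrite /entropy_transition /= => ->.
by case: a aB {a1} => //; rewrite eqxx.
Qed.

Lemma leads_stop v ks : v Output = 0%N ->
  leads (holds Read v [::] ks) (holds Stop (fun i => if i == Output then 1 else v i)%N [::] ks).
Proof.
move=> v0; apply: leads_step => c cq; rewrite (step_transition _ _ cq) // /entropy_transition /=.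
case: cq => _ _ cv; rewrite ffunE.
have [r [_ Or]] := cv Oracle; have -> : scan (tapes c Oracle) = Blank.
  by rewrite /scan Or; case: r {Or}.
split=> // i /=; rewrite !ffunE.
have := cv i; case: i; try exact: represents_keep.
by rewrite v0 => -[r' ->]; exists r'.-1; case: r'.
Qed.

Lemma list_code_letters n (ws : seq (n.-tuple 'I_d)) :
  all (fun a => (a != One) && (a != Blank)) (list_code void ws).
Proof.
apply/allP => a /flattenP[_ /mapP[u _ ->]]; rewrite mem_rcons inE => /orP[/eqP ->|/mapP[x _ ->]];
  by apply/andP; split; apply/eqP.
Qed.

(** At each comma of the answer one unit moves from [Words] to [Spare]. A comma met with [Words]
    empty reveals too many words, and [Spare] then holds the whole bound, ready to be doubled. The
    induction needs an arbitrary initial [b]. *)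
Lemma leads_compare n (ws : seq (n.-tuple 'I_d)) a k m b ks :
  leads (holds Read (values 0 0 0 a k m b 0) (list_code void ws) ks)
    (if (size ws <= m)%N
     then holds Stop (values 0 1 0 a k (m - size ws) (b + size ws) 0) [::] ks
     else holds Grow1 (values 0 0 0 a k 0 (b + m) 0) [::] ks).
Proof.
elim: ws m b => [|u ws IH] m b /=.
  rewrite subn0 addn0 (_ : values _ 1 _ _ _ _ _ _ =
    (fun i => if i == Output then 1 else values 0 0 0 a k m b 0 i)%N).
    exact: leads_stop.
  by apply/funext; case.
rewrite /list_code /= cat_rcons; apply: leads_trans (leads_read_word _ _ _ _) _.
case: m => [|m] /=.
  apply: leads_trans (counter_zero (q := Compare) _ erefl _ _) _ => //.
  rewrite addn0; apply: leads_skip; exact: list_code_letters.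
rewrite subSS ltnS !addnS -!addSn; apply: leads_trans (IH _ _).
by apply: (@counter_pos Compare) => //; case.
Qed.

Lemma leads_ask k a m ks :
  leads (holds Ask (values 0 0 k a k m 0 0) [::] ks)
    (holds Read (values 0 0 0 a k m 0 0) (list_code void (phi k)) (k :: ks)).
Proof.
apply: leads_step; case=> q tp ks' [/= -> -> cv].
have [r [/= Ok Or]] := cv Oracle.
(* Letters and commas of earlier answers may still be on the tape, but only marks enter the
   query. *)
have kE : count_mem One (contents (tp Oracle)) = k.
  rewrite /contents count_filter catrevE count_cat count_rev Or.
  rewrite -[RHS]addn0 -[X in _ = (X + _)%N]Ok; congr (_ + _)%N.
    by apply: eq_count => x /=; case: eqP => // ->; apply/eqP.
  by elim: r {Or} => //= r ->; rewrite eqxx andbF.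
split=> //=; first by rewrite kE.
move=> i; case: eqP => [->|]; first by exists 0%N; rewrite /= kE cats0.
by move: (cv i); case: i.
Qed.

Lemma leads_round k a m ks :
  leads (holds Ask (values 0 0 k a k m 0 0) [::] ks)
    (if (size (phi k) <= m)%N
     then holds Stop (values 0 1 0 a k (m - size (phi k)) (size (phi k)) 0) [::] (k :: ks)
     else holds Ask (values 0 0 (k + a) a (k + a) (m + m) 0 0) [::] (k :: ks)).
Proof.
apply: leads_trans (leads_ask _ _ _ _) _; apply: leads_trans (leads_compare _ _ _ _ _ _) _.
by case: ifP => _; [exact: leads_refl|exact: leads_grow].
Qed.

(** Induction on [j], a bound on the rounds still to come; the search may succeed earlier, so the
    final [m] is existential. The successful query is recorded so that oracles agreeing with [phi]
    share its answer. *)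
Lemma leads_search a j m0 ks : (size (phi ((m0 + j) * a)) <= 2 ^ (m0 + j))%N ->
  exists m v ks', [/\ (size (phi (m * a)) <= 2 ^ m)%N, (m * a)%N \in ks', v Output = 1%N &
    leads (holds Ask (values 0 0 (m0 * a) a (m0 * a) (2 ^ m0) 0 0) [::] ks)
      (holds Stop v [::] ks')].
Proof.
elim: j m0 ks => [|j IH] m0 ks le_j.
  rewrite addn0 in le_j; have := leads_round (m0 * a) a (2 ^ m0) ks; rewrite le_j => L.
  by do 3!eexists; split; [exact: le_j|exact: mem_head| |exact: L].
have := leads_round (m0 * a) a (2 ^ m0) ks; case: ifP => [le_0|_] L.
  by do 3!eexists; split; [exact: le_0|exact: mem_head| |exact: L].
rewrite addnn -mul2n -expnS addnC -mulSn in L.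
rewrite addnS -addSn in le_j; have [m [v [ks' [le_m ksm vO L']]]] := IH _ ((m0 * a)%N :: ks) le_j.
by exists m, v, ks'; split=> //; apply: leads_trans L L'.
Qed.

Lemma entropy_machine_outputs n j : (size (phi (j * 2 ^ n)) <= 2 ^ j)%N ->
  exists m ks, [/\ (size (phi (m * 2 ^ n)) <= 2 ^ m)%N, (m * 2 ^ n)%N \in ks &
    outputs entropy_machine phi n 0 ks].
Proof.
move=> le_j; have [m [v [ks [le_m ksm vO L]]]] := @leads_search (2 ^ n) j 0 [::] le_j.
exists m, ks; split=> //.
have start : holds Double1 (values n 0 0 1 0 1 0 0) [::] [::]
    (step phi (initial entropy_machine n)).
  split=> // i /=; rewrite ffunE; case: i; rewrite ?ffunE; try by exists 0%N.
    by apply: represents_keep; exists 0%N; rewrite cats0.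
  by apply: represents_keep; exists 0%N.
have init := leads_double n 1 [::]; rewrite mul1n in init.
have [/(_ _ start)[t]] := leads_trans init L.
rewrite -iterSr => -[cS cks cv].
exists t.+1; split=> //.
(* No sign, an empty numerator and denominator [0.+1]: the output denotes 0. *)
exists false, 0%N, 0%N; split; last by rewrite mul0r mulr0.
have [r] := cv Output; rewrite vO /contents => ->.
have CB : Comma != Blank :> sym by apply/eqP.
have OB : One != Blank :> sym by apply/eqP.
by rewrite /= CB OB; elim: r => //= r IH; rewrite eqxx.
Qed.

End Simulation.
End EntropyMachine.

(** * From word counts to entropy bounds, and the conclusion *)

Section Entropy.
Variables (R : realType) (d : nat).
Implicit Types X : shift_space d.

(** Since [ln 2 <= 1], the logarithm of the count is at most [m], and the length exceeds
    [m * 2 ^ n]; the final successor keeps this strict even for [m = 0]. *)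
Lemma htop_lt X n m : (#|language X (m * 2 ^ n).*2.+1| <= 2 ^ m)%N ->
  `|ratr 0 - htop R X| < 2 ^- n.
Proof.
move=> c_le; have [_ h_ge0 h_le] := htop_cvg R X.
rewrite rmorph0 sub0r normrN ger0_norm //; apply: le_lt_trans (h_le (m * 2 ^ n).*2.+1 _) _ => //.
have c_gt0 : 0 < #|language X (m * 2 ^ n).*2.+1|%:R :> R by rewrite ltr0n language_gt0.
rewrite ltr_pdivrMl ?ltr0n // ltr_pdivlMr ?exprn_gt0 //.
have ln_c : ln (#|language X (m * 2 ^ n).*2.+1|%:R : R) <= m%:R.
  apply: (@le_trans _ _ (ln (2 ^+ m : R))).
    by rewrite ler_ln ?posrE ?exprn_gt0 // -natrX ler_nat.
  rewrite lnXn // ler_wMn2r // (_ : 2 = 1 + 1 :> R) //.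
  by apply: le_ln1Dx; rewrite (lt_trans (ltrN10 R)) ?ltr01.
apply: (@le_lt_trans _ _ (m%:R * 2 ^+ n)); first by rewrite ler_pM2r ?exprn_gt0.
by rewrite -natrX -natrM ltr_nat ltnS -addnn leq_addr.
Qed.

Lemma exists_few_words X n : htop R X = 0 ->
  exists j, (#|language X (j * 2 ^ n).*2.+1| <= 2 ^ j)%N.
Proof.
move=> h0; have [+ _ _] := htop_cvg R X; rewrite h0 => /cvgrPdist_le c_cvg.
have ln2_gt0 : 0 < ln 2 :> R by rewrite ln_gt0 // ltr1n.
(* The tolerance is chosen because the length [2 j 2^n + 1] is at most [j 2^(n+2)] for [j > 0];
   taking [j = N.+1] ensures positivity. *)
have [|N _ c_le] := c_cvg (ln 2 / 2 ^+ n.+2); first by rewrite divr_gt0 ?exprn_gt0.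
exists N.+1; set L := ((N.+1 * 2 ^ n).*2.+1)%N.
have N_L : (N <= L)%N.
  have : (N.+1 * 1 <= N.+1 * 2 ^ n)%N by rewrite leq_mul2l expn_gt0.
  by rewrite /L; lia.
have c_gt0 : 0 < #|language X L|%:R :> R by rewrite ltr0n language_gt0.
have := c_le L N_L; rewrite sub0r normrN => /(le_trans (ler_norm _)).
rewrite ler_pdivrMl ?ltr0n // => ln_c.
rewrite -(ler_nat R) natrX -ler_ln ?posrE ?exprn_gt0 // lnXn //.
apply: le_trans ln_c _; rewrite mulrCA -[leRHS]mulr_natr ler_pM2l //.
rewrite ler_pdivrMr ?exprn_gt0 // -natrX -natrM ler_nat /L 2!expnS.
have : (0 < N.+1 * 2 ^ n)%N by rewrite muln_gt0 expn_gt0.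
by lia.
Qed.

Lemma size_oracle phi X n : is_oracle phi X -> size (phi n) = #|language X n.*2.+1|.
Proof. by move=> /(_ n)[/card_uniqP <- /eq_card ->]. Qed.

Lemma entropy_machine_computes X : htop R X = 0 ->
  computes_at (entropy_machine d) (@htop R d) X.
Proof.
move=> h0 phi phiP n; have [j] := exists_few_words n h0.
rewrite -(size_oracle _ phiP) => /entropy_machine_outputs[m [ks [le_m ks_m out]]].
exists 0, ks; split=> //; first by apply: (@htop_lt _ _ m); rewrite -(size_oracle _ phiP).
(* The answer that ended the search was queried, so [psi] gives it too and it bounds the entropy of
   [Y] likewise. *)
move=> Y psi psiP psi_phi; apply: (@htop_lt _ _ m).
by rewrite -(size_oracle _ psiP) (psi_phi _ _ (leqnn _) ks_m).
Qed.

End Entropy.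

Theorem corollary5 (R : realType) (d : nat) :
  (forall X0 : shift_space d,
     computable_at (@htop R d) X0 <-> htop R X0 = 0) /\
  (exists M : machine d, forall X0 : shift_space d,
     htop R X0 = 0 -> computes_at M (@htop R d) X0).
Proof.
split; last by exists (entropy_machine d) => X0; exact: entropy_machine_computes.
move=> X0; split; first exact: computable_htop_eq0.
by move=> h0; exists (entropy_machine d); exact: entropy_machine_computes.
Qed.
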